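(* Let $N\ge 1$ be an integer, let $Q_N$ and $P_N$ be the $(N+1)\times(N+1)$ position and momentum matrices, and let $D_N=(Q_NP_N-P_NQ_N)/i$ be the action difference. Let $U_N=[u_0^{(N)},\dots,u_N^{(N)}]$ be the modal matrix of $Q_N$. Then the action difference in the position representation is $$D_N^{(q)}:=U_N^\dagger D_N U_N=I_N-J_N,$$ where $I_N$ is the $(N+1)\times(N+1)$ identity matrix and $J_N$ is the $(N+1)\times(N+1)$ matrix all of whose entries equal $1$.
   Context: Rows and columns are indexed by $0,1,\dots,N$. The position matrix $Q_N$ is the real symmetric tridiagonal matrix with $(Q_N)_{k,k+1}=(Q_N)_{k+1,k}=\sqrt{k+1}/\sqrt{2}$ for $k=0,\dots,N-1$ and all other entries $0$. The momentum matrix $P_N$ is the Hermitian tridiagonal matrix with $(P_N)_{k,k+1}=-i\sqrt{k+1}/\sqrt{2}$ and $(P_N)_{k+1,k}=i\sqrt{k+1}/\sqrt{2}$ for $k=0,\dots,N-1$ and all other entries $0$. The matrix $Q_N$ has $N+1$ pairwise distinct real eigenvalues $\lambda_0,\dots,\lambda_N$. The modal matrix $U_N$ has as its $l$-th column the real eigenvector $u_l^{(N)}$ of $Q_N$ for $\lambda_l$, normalized to Euclidean norm $1$ and with its sign chosen so that its last component (index $N$) is nonnegative. $\dagger$ denotes the conjugate transpose. *)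

(* Defs.v *)
From mathcomp Require Export all_boot all_order all_algebra.
From mathcomp Require Export sesquilinear spectral complex reals.

Set Implicit Arguments.
Unset Strict Implicit.
Unset Printing Implicit Defensive.

Import Order.TTheory GRing.Theory Num.Theory.

Local Open Scope ring_scope.
Local Open Scope complex_scope.
Local Open Scope sesquilinear_scope.

(* The index set {0, ..., N} is 'I_N.+1. *)

Definition position_mx (R : realType) (N : nat) : 'M[R]_N.+1 :=
  \matrix_(j, k) (if k == j.+1 :> nat then Num.sqrt j.+1%:R / Num.sqrt 2
                  else if j == k.+1 :> nat then Num.sqrt k.+1%:R / Num.sqrt 2
                  else 0).

Definition momentum_mx (R : realType) (N : nat) : 'M[R[i]]_N.+1 :=
  \matrix_(j, k) (if k == j.+1 :> nat then
                    - 'i * (Num.sqrt j.+1%:R / Num.sqrt 2 : R)%:C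
                  else if j == k.+1 :> nat then
                    'i * (Num.sqrt k.+1%:R / Num.sqrt 2 : R)%:C
                  else 0).

(* A real matrix viewed as a complex one. *)
Definition complex_mx (R : realType) (m n : nat) (A : 'M[R]_(m, n)) :
    'M[R[i]]_(m, n) :=
  map_mx (fun x : R => x%:C) A.

Definition action_difference (R : realType) (N : nat) : 'M[R[i]]_N.+1 :=
  let Q := complex_mx (position_mx R N) in
  let P := momentum_mx R N in
  'i^-1 *: (Q *m P - P *m Q).

(* [is_modal_mx lam U]: lam enumerates, in an arbitrary order, the N + 1
   pairwise distinct eigenvalues of the position matrix, and U is the modal
   matrix for this enumeration. The eigenvector equation, the unit norm and
   the sign condition determine each column of U uniquely: the last component
   of an eigenvector of this tridiagonal matrix is nonzero. *)
Definition is_modal_mx (R : realType) (N : nat) (lam : 'I_N.+1 -> R)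
    (U : 'M[R]_N.+1) : Prop :=
  injective lam /\
  forall l : 'I_N.+1,
    [/\ position_mx R N *m col l U = lam l *: col l U,
        Num.sqrt (\sum_(k < N.+1) U k l ^+ 2) = 1
      & 0 <= U ord_max l].

(* M ^t* is the conjugate transpose of M. *)
Definition action_difference_q (R : realType) (N : nat) (U : 'M[R]_N.+1) :
    'M[R[i]]_N.+1 :=
  (complex_mx U) ^t* *m action_difference R N *m complex_mx U.

(* Main.v *)
Require Import Defs.
From mathcomp Require Import all_boot all_order all_algebra.
From mathcomp Require Import sesquilinear spectral complex reals.
From mathcomp Require Import ring.

Set Implicit Arguments.
Unset Strict Implicit.
Unset Printing Implicit Defensive.

Import Order.TTheory GRing.Theory Num.Theory.

Local Open Scope ring_scope.
Local Open Scope complex_scope.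

(** Over the reals [P = i K], where [Q = A + A^T] and [K = A^T - A] for the
    annihilation matrix [A], so [D = Q K - K Q = 2 (A A^T - A^T A)], which is
    [I - (N+1) e_N e_N^T]. As [U] is orthogonal, [U^T D U = I - (N+1) v^T v],
    where [v] is the last row of [U]. On the other hand [Q U = U L] with [L]
    diagonal, so [U^T D U] is the commutator of [L] with [U^T K U] and has zero
    diagonal: hence [(N+1) v_l^2 = 1] for all [l], and [v_l >= 0] gives
    [v_l = 1 / sqrt (N+1)]. *)

Definition annihilation_mx (R : rcfType) (N : nat) : 'M[R]_N.+1 :=
  \matrix_(j, k) (if k == j.+1 :> nat then Num.sqrt j.+1%:R / Num.sqrt 2
                  else 0).

Definition real_momentum_mx (R : rcfType) (N : nat) : 'M[R]_N.+1 :=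
  (annihilation_mx R N)^T - annihilation_mx R N.

Lemma complex_mxE (R : realType) (m n : nat) (A : 'M[R]_(m, n)) :
  complex_mx A = map_mx (real_complex R) A.
Proof. by []. Qed.

Lemma position_mxE (R : realType) (N : nat) :
  position_mx R N = annihilation_mx R N + (annihilation_mx R N)^T.
Proof.
apply/matrixP => j k; rewrite !mxE.
case: eqP => [->|_]; last by rewrite add0r.
by rewrite ltn_eqF ?addr0 // ltnW.
Qed.

Lemma tr_position_mx (R : realType) (N : nat) :
  (position_mx R N)^T = position_mx R N.
Proof. by rewrite position_mxE linearD /= trmxK addrC. Qed.

Lemma momentum_mxE (R : realType) (N : nat) :
  momentum_mx R N = 'i *: complex_mx (real_momentum_mx R N).
Proof.
apply/matrixP => j k; rewrite !mxE.
case: eqP => [->|_].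
  by rewrite ltn_eqF ?sub0r 1?ltnW // raddfN mulNr mulrN.
by case: eqP => _; rewrite subr0 ?mulr0.
Qed.

Lemma annihilation_sqr (R : rcfType) (j : nat) :
  (Num.sqrt j.+1%:R / Num.sqrt 2) * (Num.sqrt j.+1%:R / Num.sqrt 2)
    = j.+1%:R / 2 :> R.
Proof. by rewrite -expr2 exprMn exprVn !sqr_sqrtr ?ler0n. Qed.

(** Row [j] of [A] has its only nonzero entry in column [j.+1]. Truncation removes that column when
    [j = N], so the last row is zero; this is the source of the exceptional corner of [D]. *)
Lemma annihilation_mul_tr (R : rcfType) (N : nat) (j k : 'I_N.+1) :
  (annihilation_mx R N *m (annihilation_mx R N)^T) j k
    = (if (j == k) && (j < N)%N then j.+1%:R / 2 else 0).
Proof.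
rewrite mxE; case: (ltnP j N) => [ltjN|leNj]; last first.
  rewrite andbF big1 // => m _; rewrite !mxE.
  by rewrite ltn_eqF ?mul0r // (leq_trans (ltn_ord m)).
rewrite andbT (bigD1 (Ordinal (ltjN : j.+1 < N.+1)%N)) //= big1 ?addr0.
  rewrite !mxE /= eqxx eqSS -val_eqE /=.
  by case: eqP => [<-|_]; rewrite ?annihilation_sqr ?mulr0.
move=> m; rewrite -val_eqE /= => neq; rewrite !mxE.
by rewrite (negbTE neq) mul0r.
Qed.

(** Column [j.+1] of [A] has its only nonzero entry in row [j], and column 0 is zero. Truncation
    causes no defect here. *)
Lemma annihilation_tr_mul (R : rcfType) (N : nat) (j k : 'I_N.+1) :
  ((annihilation_mx R N)^T *m annihilation_mx R N) j k
    = (if j == k then j%:R / 2 else 0).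
Proof.
rewrite mxE; case: j => [[|j] ltjN].
  rewrite mul0r if_same big1 // => m _.
  by rewrite !mxE /= mul0r.
rewrite (bigD1 (Ordinal (ltnW ltjN))) //= big1 ?addr0.
  rewrite !mxE /= eqxx -val_eqE /= eq_sym.
  by case: eqP => _; rewrite ?annihilation_sqr ?mulr0.
move=> m; rewrite -val_eqE /= => neq; rewrite !mxE /= eqSS eq_sym.
by rewrite (negbTE neq) mul0r.
Qed.

Lemma position_momentum_commutator (R : realType) (N : nat) :
  position_mx R N *m real_momentum_mx R N
    - real_momentum_mx R N *m position_mx R N
  = 1%:M - N.+1%:R *: delta_mx ord_max ord_max.
Proof.
set A := annihilation_mx R N.
have ->: position_mx R N *m real_momentum_mx R N
    - real_momentum_mx R N *m position_mx R N
    = 2 *: (A *m A^T - A^T *m A).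
  (* The terms in [A *m A] and [A^T *m A^T] cancel, and each mixed product occurs twice. With the
     products generalized, this is a linear identity that [ring] checks entrywise. *)
  rewrite position_mxE /real_momentum_mx -/A !(mulmxBr, mulmxBl, mulmxDl, mulmxDr).
  move: (A *m A) (A *m A^T) (A^T *m A) (A^T *m A^T) => B C D E.
  by apply/matrixP => j k; rewrite !mxE; ring.
apply/matrixP => j k.
have two_neq0 : 2 != 0 :> R by rewrite pnatr_eq0.
rewrite [LHS]mxE [X in 2 * X]mxE [X in _ + X]mxE /A annihilation_mul_tr annihilation_tr_mul !mxE.
have [<-|neq] := eqVneq j k; last first.
  rewrite /= !mulr0n [_ && _]negbTE ?mulr0 ?subrr ?mulr0 //.
  by apply: contra neq => /andP[/eqP-> /eqP->].
rewrite /= andbb -val_eqE /=.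
(* For [j < N] the entry is [(j + 1) - j = 1]; for [j = N] only [- N = 1 - (N + 1)] is left. *)
have [ltjN|leNj] := ltnP j N.
  by rewrite ltn_eqF //= -mulrBl mulrCA divff // -natrB // subSnn !mulr1 mulr0 subr0.
have ->: j = N :> nat by apply/eqP; rewrite eqn_leq leNj -ltnS ltn_ord.
by rewrite eqxx /= mulr1 sub0r mulrN mulrCA divff // mulr1 -natr1; ring.
Qed.

Lemma position_mx_modal (R : realType) (N : nat) (lam : 'I_N.+1 -> R)
    (U : 'M[R]_N.+1) : is_modal_mx lam U ->
  position_mx R N *m U = U *m diag_mx (\row_l lam l).
Proof.
case=> _ hU; apply/matrixP => j l; have [+ _ _] := hU l.
rewrite colE mulmxA -!colE => /colP/(_ j).
by rewrite mul_mx_diag [LHS]mxE => ->; rewrite !mxE mulrC.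
Qed.

Lemma tr_modal_position_mx (R : realType) (N : nat) (lam : 'I_N.+1 -> R)
    (U : 'M[R]_N.+1) : is_modal_mx lam U ->
  U^T *m position_mx R N = diag_mx (\row_l lam l) *m U^T.
Proof.
move/position_mx_modal/(congr1 trmx).
by rewrite !trmx_mul tr_position_mx tr_diag_mx.
Qed.

(** As [Q] is symmetric, the Gram matrix [G] of the columns commutes with the diagonal matrix of
    eigenvalues, so [(lam l - lam m) * G l m = 0]; injectivity of [lam] kills the off-diagonal
    entries. *)
Lemma modal_mx_orthogonal (R : realType) (N : nat) (lam : 'I_N.+1 -> R)
    (U : 'M[R]_N.+1) : is_modal_mx lam U -> U^T *m U = 1%:M.
Proof.
move=> hU; have [lam_inj hcol] := hU; apply/matrixP => l m.
rewrite [RHS]mxE; have [<-|neq] := eqVneq l m.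
  have [_ norm1 _] := hcol l.
  rewrite mxE -[RHS](expr1n R 2) -norm1 sqr_sqrtr; last first.
    by apply: sumr_ge0 => k _; exact: sqr_ge0.
  by apply: eq_bigr => k _; rewrite mxE.
have: diag_mx (\row_l lam l) *m (U^T *m U)
    = (U^T *m U) *m diag_mx (\row_l lam l).
  by rewrite mulmxA -(tr_modal_position_mx hU) -!mulmxA (position_mx_modal hU).
move: (U^T *m U) => G.
move/matrixP/(_ l m); rewrite mul_diag_mx mul_mx_diag !mxE => /eqP.
rewrite [X in _ == X]mulrC -subr_eq0 -mulrBl mulf_eq0 subr_eq0.
by rewrite (inj_eq lam_inj) (negbTE neq) => /eqP.
Qed.

Lemma modal_commutator (R : realType) (N : nat) (lam : 'I_N.+1 -> R)
    (U K : 'M[R]_N.+1) (l : 'I_N.+1) : is_modal_mx lam U ->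
  (U^T *m (position_mx R N *m K - K *m position_mx R N) *m U) l l = 0.
Proof.
move=> hU; set L := diag_mx (\row_l lam l).
have -> : U^T *m (position_mx R N *m K - K *m position_mx R N) *m U
    = L *m (U^T *m K *m U) - (U^T *m K *m U) *m L.
  rewrite mulmxBr mulmxBl !mulmxA (tr_modal_position_mx hU).
  by rewrite -!(mulmxA (U^T *m K)) (position_mx_modal hU).
move: (U^T *m K *m U) => M; rewrite /L mul_diag_mx mul_mx_diag !mxE mulrC.
exact: subrr.
Qed.

Lemma modal_action_difference (R : realType) (N : nat) (lam : 'I_N.+1 -> R)
    (U : 'M[R]_N.+1) : is_modal_mx lam U ->
  U^T *m (position_mx R N *m real_momentum_mx R N
          - real_momentum_mx R N *m position_mx R N) *m U
  = 1%:M - const_mx 1.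
Proof.
move=> hU; have [_ hcol] := hU.
set D := _ - _ *m position_mx R N.
have DE l m : (U^T *m D *m U) l m
    = (l == m)%:R - N.+1%:R * (U ord_max l * U ord_max m).
  rewrite /D position_momentum_commutator mulmxBr mulmxBl mulmx1.
  rewrite (modal_mx_orthogonal hU) -scalemxAr -scalemxAl.
  (* Splitting the corner unit matrix into a column times a row turns its conjugate by [U] into the
     outer product of the last row of [U] with itself. *)
  rewrite -(mul_delta_mx (ord0 : 'I_1)) mulmxA -colE -mulmxA -rowE.
  by rewrite !mxE big_ord1 !mxE.
have last_sqr l : N.+1%:R * (U ord_max l * U ord_max l) = 1.
  apply/esym/eqP; rewrite -subr_eq0 -[X in X - _]/(true%:R) -(eqxx l) -DE.
  by rewrite (modal_commutator _ _ hU).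
(* Nonnegative numbers with equal squares agree. Comparing with column 0 reduces every product of
   last-row entries to a square, so the value [1 / sqrt (N + 1)] never has to be written. *)
have lastE l : U ord_max l = U ord_max ord0.
  have [_ _ ge0l] := hcol l; have [_ _ ge00] := hcol ord0.
  apply/eqP; rewrite -(eqrXn2 (n := 2)) // !expr2.
  have neq0 : N.+1%:R != 0 :> R by rewrite pnatr_eq0.
  by rewrite -(inj_eq (mulfI neq0)) !last_sqr.
by apply/matrixP => l m; rewrite DE !mxE (lastE l) (lastE m) last_sqr.
Qed.

(** The factor ['i] of the momentum matrix cancels ['i^-1], which moves the whole computation to
    real matrices. *)
Lemma action_differenceE (R : realType) (N : nat) :
  action_difference R N
    = complex_mx (position_mx R N *m real_momentum_mx R N
                  - real_momentum_mx R N *m position_mx R N).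
Proof.
rewrite /action_difference momentum_mxE -scalemxAr -scalemxAl -scalerBr scalerA.
by rewrite mulVf ?neq0Ci // scale1r !complex_mxE [RHS]map_mxB !map_mxM.
Qed.

Theorem mainTheorem4 (R : realType) (N : nat) (hN : (1 <= N)%N)
    (lam : 'I_N.+1 -> R) (U : 'M[R]_N.+1) (hU : is_modal_mx lam U) :
  action_difference_q U = (1%:M - const_mx 1 :> 'M[R[i]]_N.+1).
Proof.
rewrite /action_difference_q action_differenceE.
have -> : map_mx Num.conj (complex_mx U)^T = complex_mx U^T.
  by apply/matrixP => j k; rewrite !mxE; exact: conjc_real.
rewrite !complex_mxE -!map_mxM (modal_action_difference hU) map_mxB map_scalar_mx.
by rewrite map_const_mx !rmorph1.
Qed.
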